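(* There is a constant $C_d$ depending only on $d$ such that the following holds. Let $B\subset\mathbb{R}^d$ be an open ball of radius $r$, let $\tilde B$ be the ball with the same center and radius $2r$, let $\mathbf f=(f_1,\dots,f_n)\in C^2(\tilde B)$, let $\delta>0$, and let $$L=\sup_{|\beta|=2,\ x\in\tilde B}\|\partial_\beta\mathbf f(x)\|,$$ assumed finite and positive. Then for every $\mathbf q\in\mathbb{Z}^n$ with $\|\mathbf q\|\ge\frac{1}{4nLr^2}$, the set of $x\in B$ satisfying both $$\langle\!\langle\mathbf f(x)\mathbf q\rangle\!\rangle<\delta\qquad\text{and}\qquad\|\nabla\mathbf f(x)\mathbf q\|\ge\sqrt{ndL\|\mathbf q\|}$$ has Lebesgue measure at most $C_d\,\delta\,|B|$.
   Context: $\mathbf f(x)$ is a row vector and $\mathbf q$ a column vector, $\mathbf f(x)\mathbf q=\sum_iq_if_i(x)$. $\nabla\mathbf f(x)$ denotes the $d\times n$ matrix whose rows are the partial derivatives $\partial_i\mathbf f(x)$, so $\nabla\mathbf f(x)\mathbf q\in\mathbb{R}^d$ is the gradient of $x\mapsto\mathbf f(x)\mathbf q$. All norms are sup-norms: $\|\mathbf v\|=\max_i|v_i|$. $\langle\!\langle t\rangle\!\rangle$ is the distance from $t$ to the nearest integer. $|\cdot|$ is Lebesgue measure. For a multiindex $\beta$, $|\beta|$ is its order and $\partial_\beta$ the corresponding partial derivative. *)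

(* Defs.v *)
From HB Require Import structures.
From mathcomp Require Import all_boot all_order all_algebra.
From mathcomp Require Import all_classical all_reals all_analysis.
Set Implicit Arguments. Unset Strict Implicit. Unset Printing Implicit Defensive.
Import Order.TTheory GRing.Theory Num.Theory.
Import numFieldNormedType.Exports.
Local Open Scope classical_set_scope.
Local Open Scope ring_scope.

Section Defs.
Variable R : realType.

Definition evec (d : nat) (i : 'I_d) : 'rV[R]_d := delta_mx 0 i.

Definition pderiv (d : nat) (W : normedModType R) (g : 'rV[R]_d -> W) (i : 'I_d)
  : 'rV[R]_d -> W := fun x => derive g x (evec i).

Definition C2_on (d : nat) (W : normedModType R) (U : set 'rV[R]_d)
  (g : 'rV[R]_d -> W) : Prop :=
  {in U, continuous g} /\
  (forall i : 'I_d, {in U, forall x, derivable g x (evec i)}) /\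
  (forall i : 'I_d, {in U, continuous (pderiv g i)}) /\
  (forall i j : 'I_d, {in U, forall x, derivable (pderiv g j) x (evec i)}) /\
  (forall i j : 'I_d, {in U, continuous (pderiv (pderiv g j) i)}).

Definition dist_int (t : R) : R := inf [set `|t - z%:~R| | z in [set: int]].

Definition box (d : nat) (a b : 'rV[R]_d) : set 'rV[R]_d :=
  [set x | forall j : 'I_d, a 0 j <= x 0 j < b 0 j].
Definition box_vol (d : nat) (a b : 'rV[R]_d) : R :=
  \prod_(j < d) Num.max 0 (b 0 j - a 0 j).

Definition lebesgue_outer (d : nat) (A : set 'rV[R]_d) : \bar R :=
  ereal_inf [set (\sum_(0 <= k <oo) (box_vol (ab k).1 (ab k).2)%:E)%E
            | ab in [set ab : nat -> 'rV[R]_d * 'rV[R]_d |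
                     A `<=` \bigcup_k box (ab k).1 (ab k).2]].

End Defs.

(* Main.v *)
(** On a cube of side s comparable to 1/D, where D ^ 2 = d M and M bounds the second
    derivatives of g = f q, the gradient of g is nearly constant. If the cube meets the set,
    then in the direction j of the largest partial derivative, of size G >= D, the function g
    is bi-Lipschitz with constants comparable to G, hence on a line it spends a proportion
    O(delta) of the length within delta of an integer: it crosses O(G s) integers and stays
    O(delta / G) near each of them. Cutting the cube into columns that are long in direction j
    and so thin in the others that g varies there by at most delta turns each crossing into a
    box, so that explicit finite box covers replace Fubini's theorem. The dyadic cubes of side
    about 1/D tile the ball, since the lower bound on |q| says that r is at least of order
    1/D. *)

Require Import Defs.
From HB Require Import structures.
From mathcomp Require Import all_boot all_order all_algebra.
From mathcomp Require Import all_classical all_reals all_analysis.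
From mathcomp Require Import measurable_realfun zify ring lra.
Import Order.TTheory GRing.Theory Num.Theory.
Import numFieldNormedType.Exports.
Local Open Scope classical_set_scope.
Local Open Scope ring_scope.

Set Implicit Arguments.
Unset Strict Implicit.

(** * Lower bound for the volume of countable box covers of a ball *)

Lemma lebesgue_measure_co (R : realType) (a b : R) :
  lebesgue_measure (`[a, b[ : set R)%classic = (Num.max 0 (b - a))%:E.
Proof.
rewrite lebesgue_measure_itv /= lte_fin; case: ltP => ab.
  by rewrite -EFinB max_r // subr_ge0 ltW.
by rewrite max_l // subr_le0.
Qed.

(* The weights make the induction on d work: integrating the hypothesis over the last
   coordinate moves the last side length of each box into its weight. *)
Lemma weighted_boxes_volume_ge (R : realType) (d : nat) (a b : nat -> R)
    (A B : nat -> nat -> R) (w : nat -> R) (v : R) :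
  (forall j, a j <= b j) -> (forall k, 0 <= w k) -> 0 <= v ->
  (forall x : nat -> R, (forall j, (j < d)%N -> a j < x j < b j) ->
    (v%:E <= \sum_(0 <= k <oo)
      (w k * \prod_(j < d) \1_(`[A k j, B k j[%classic) (x j))%:E)%E) ->
  ((v * \prod_(j < d) (b j - a j))%:E <=
     \sum_(0 <= k <oo) (w k * \prod_(j < d) Num.max 0 (B k j - A k j))%:E)%E.
Proof.
move=> ab; elim: d v w => [|d IHd] v w w0 v0 H.
  have := H (fun=> 0) (fun j => ltac:(by [])).
  under eq_eseriesr do rewrite big_ord0.
  by under [X in _ -> (_ <= X)%E]eq_eseriesr do rewrite big_ord0; rewrite big_ord0 mulr1.
rewrite big_ord_recr /= [X in v * X]mulrC mulrA.
under eq_eseriesr do rewrite big_ord_recr /= [X in _ * X]mulrC mulrA.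
apply: IHd => [k||x Hx].
- by rewrite mulr_ge0 // le_max lexx.
- by rewrite mulr_ge0 // subr_ge0.
pose D : set R := `]a d, b d[%classic.
have mD : measurable D by exact: measurable_itv.
pose c k : R := w k * \prod_(j < d) \1_(`[A k j, B k j[%classic) (x j).
have c0 k : 0 <= c k by rewrite mulr_ge0 // prodr_ge0.
pose F k t : \bar R := ((c k)%:E * (\1_(`[A k d, B k d[%classic) t)%:E)%E.
have F0 k t : (0 <= F k t)%E by rewrite mule_ge0 // lee_fin.
have mF k : measurable_fun D (F k).
  apply: measurable_funeM; apply/measurable_EFinP.
  exact/measurable_indic.
have HF t : D t -> (v%:E <= \sum_(0 <= k <oo) F k t)%E.
  move=> Dt; have := H (fun j => if (j == d)%N then t else x j).
  move=> /(_ _)/le_trans; apply.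
    move=> j; rewrite ltnS leq_eqVlt; case: eqP => [->|_ /= jd]; last exact: Hx.
    by move: Dt; rewrite /D /= in_itv.
  apply: lee_nneseries => [k _ _|k _].
    by rewrite lee_fin mulr_ge0 // prodr_ge0.
  rewrite big_ord_recr /= eqxx mulrA /F -EFinM lee_fin.
  rewrite le_eqVlt; apply/orP; left; apply/eqP; congr (_ * _ * _).
  by apply: eq_bigr => j _; rewrite (ltn_eqF (ltn_ord j)).
(* Integrate over the last coordinate; the terms are nonnegative, so sum and integral commute. *)
have : (\int[lebesgue_measure]_(t in D) (cst v%:E t) <=
   \int[lebesgue_measure]_(t in D) \sum_(0 <= k <oo) F k t)%E.
  apply: ge0_le_integral => //.
  by apply: (@ge0_emeasurable_sum _ _ R D F xpredT) => // k x0 _ _; exact: F0.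
rewrite integral_cst // integral_nneseries // => H1.
have -> : (v * (b d - a d))%:E = (v%:E * lebesgue_measure D)%E.
  rewrite lebesgue_measure_itv /= lte_fin; case: ltP => [_|ba].
    by rewrite -EFinB -EFinM.
  have -> : b d = a d by apply/eqP; rewrite eq_le ba ab.
  by rewrite subrr mulr0 mule0.
apply: (le_trans H1); apply: lee_nneseries => [k _ _|k _].
  exact: integral_ge0.
rewrite /F ge0_integralZl_EFin //; last exact/measurable_EFinP/measurable_indic.
rewrite integral_indic //.
rewrite [leRHS](_ : _ = (c k)%:E * lebesgue_measure `[A k d, B k d[%classic)%E; last first.
  by rewrite lebesgue_measure_co -EFinM mulrAC.
(* Integrating the indicator over [D] gives the measure of an intersection, at most that of the
   whole interval. *)
rewrite lee_wpmul2l ?lee_fin //.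
by apply: le_measure; rewrite ?inE //; apply: measurableI.
Qed.

(** In the sup-norm the ball is an open cube of side [2 * r]. The indicators of any cover sum to at
    least 1 on it, so the weighted bound with unit weights applies. This converts a bound by the
    volume of the cube into one by the outer measure of the ball. *)
Lemma lebesgue_outer_ball_ge (R : realType) (d : nat) (c : 'rV[R]_d) (r : R) :
  0 < r -> (((2 * r) ^+ d)%:E <= lebesgue_outer (ball c r))%E.
Proof.
move=> r0; apply: le_ereal_inf_tmp => _ /= [ab Hab <-].
(* The weighted bound indexes coordinates by [nat]; those from [d] on are set to 0. *)
pose ext (u : 'rV[R]_d) (j : nat) : R :=
  if insub j is Some i then u 0 (i : 'I_d) else 0.
have extE u (j : 'I_d) : ext u j = u 0 j by rewrite /ext valK.
have := @weighted_boxes_volume_ge R d (fun j => ext c j - r) (fun j => ext c j + r)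
   (fun k => ext (ab k).1) (fun k => ext (ab k).2) (fun=> 1) 1.
have -> : \prod_(j < d) (ext c j + r - (ext c j - r)) = (2 * r) ^+ d.
  by rewrite (eq_bigr (fun=> 2 * r)) ?prodr_const ?card_ord // => j _; ring.
rewrite mul1r => /(_ _ _ _ _)/le_trans; apply => //.
- by move=> j; lra.
- move=> x Hx; pose y : 'rV[R]_d := \row_j x j.
  have [] := Hab y.
    split=> // i j; rewrite (ord1 i) mxE.
    have := Hx j (ltn_ord j); rewrite extE => /andP[h1 h2].
    by rewrite /ball /= ltr_distlC h1 h2.
  move=> k _ yk.
  (* The box containing [y] already contributes 1, and the other terms are nonnegative. *)
  rewrite (@nneseries_split _ _ 0 k.+1) ?add0n; last first.
    by move=> m _; rewrite lee_fin mul1r prodr_ge0.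
  rewrite big_nat_recr //= -[leLHS]add0e -[leLHS]adde0 leeD //; last first.
    by apply: nneseries_ge0 => m _ _; rewrite lee_fin mul1r prodr_ge0.
  rewrite leeD ?sume_ge0 // => [m _|].
    by rewrite lee_fin mul1r prodr_ge0.
  rewrite lee_fin mul1r big1 // => j _.
  rewrite indicE mem_set //= in_itv /= !extE.
  by have := yk j; rewrite mxE.
apply: lee_nneseries => [k _ _|k _].
  by rewrite lee_fin mul1r prodr_ge0 // => j _; rewrite le_max lexx.
rewrite lee_fin mul1r le_eqVlt; apply/orP; left; apply/eqP.
by apply: eq_bigr => j _; rewrite !extE.
Qed.

(** * Finite box covers and bisection of boxes *)

Lemma box_vol_ge0 (R : realType) (d : nat) (a b : 'rV[R]_d) : 0 <= box_vol a b.
Proof. by apply: prodr_ge0 => j _; rewrite le_max lexx. Qed.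

Definition upd (R : realType) (d : nat) (u : 'rV[R]_d) (i : 'I_d) (t : R) : 'rV[R]_d :=
  \row_j if j == i then t else u 0 j.

Lemma updE (R : realType) (d : nat) (u : 'rV[R]_d) (i j : 'I_d) (t : R) :
  upd u i t 0 j = if j == i then t else u 0 j.
Proof. by rewrite mxE. Qed.

(** Finite lists replace sequences, so that covers combine by concatenation and no series occurs;
    [v] is only an upper bound for the total volume. *)
Definition box_covered (R : realType) (d : nat) (A : set 'rV[R]_d) (v : R) : Prop :=
  exists2 s : seq ('rV[R]_d * 'rV[R]_d),
    (forall x, A x -> exists2 ab, ab \in s & box ab.1 ab.2 x) &
    \sum_(ab <- s) box_vol ab.1 ab.2 <= v.

Section BoxCovered.
Variables (R : realType) (d : nat).
Implicit Types (A B : set 'rV[R]_d) (a b : 'rV[R]_d) (v w : R).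

Lemma box_covered0 A v : 0 <= v -> (forall x, ~ A x) -> box_covered A v.
Proof. by move=> v0 A0; exists [::]; rewrite ?big_nil // => x /A0. Qed.

Lemma box_covered_box a b : box_covered (box a b) (box_vol a b).
Proof.
by exists [:: (a, b)]; rewrite ?big_seq1 // => x abx; exists (a, b) => //; rewrite inE.
Qed.

Lemma sub_box_covered A B v w :
  A `<=` B -> v <= w -> box_covered B v -> box_covered A w.
Proof.
move=> AB vw [s Hs sv]; exists s; last exact: le_trans sv vw.
by move=> x /AB; exact: Hs.
Qed.

Lemma box_coveredU A B v w :
  box_covered A v -> box_covered B w -> box_covered (A `|` B) (v + w).
Proof.
move=> [s Hs sv] [t Ht tw]; exists (s ++ t); last by rewrite big_cat lerD.
by move=> x [/Hs|/Ht] [ab abs ?]; exists ab => //; rewrite mem_cat abs ?orbT.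
Qed.

Lemma box_covered_bigcup (N : nat) (F : nat -> set 'rV[R]_d) v :
  (forall k, (k < N)%N -> box_covered (F k) v) ->
  box_covered (fun x => exists2 k, (k < N)%N & F k x) (N%:R * v).
Proof.
elim: N => [|N IHN] H.
  by rewrite mul0r; apply: box_covered0 => // x [].
apply: sub_box_covered (box_coveredU (IHN _) (H N (ltnSn N))); last 1 first.
- by move=> k kN; apply: H; rewrite ltnS ltnW.
- move=> x [k]; rewrite ltnS leq_eqVlt => /predU1P[->|kN] Fx; first by right.
  by left; exists k.
- by rewrite -natr1 mulrDl mul1r.
Qed.

Lemma box_split a b (i : 'I_d) (t : R) :
  box a b `<=` box a (upd b i t) `|` box (upd a i t) b.
Proof.
move=> x abx; have [xt|tx] := ltP (x 0 i) t; [left|right] => j;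
  rewrite updE; case: eqP => [->|_]; try exact: abx.
- by have /andP[-> _] := abx i.
- by have /andP[_ ->] := abx i; rewrite tx.
Qed.

Lemma box_vol_bisect a b (i : 'I_d) :
  box_vol a (upd b i ((a 0 i + b 0 i) / 2)) +
  box_vol (upd a i ((a 0 i + b 0 i) / 2)) b = box_vol a b.
Proof.
rewrite /box_vol (bigD1 i) //= [X in _ + X = _](bigD1 i) //= [RHS](bigD1 i) //=.
rewrite !updE eqxx.
under eq_bigr => j /negbTE ji do rewrite updE ji.
under [X in _ + _ * X = _]eq_bigr => j /negbTE ji do rewrite updE ji.
rewrite -mulrDl; congr (_ * _).
by case: (ltrP 0 (b 0 i - a 0 i)) => ?;
   case: (ltrP 0 ((a 0 i + b 0 i) / 2 - a 0 i)) => ?;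
   case: (ltrP 0 (b 0 i - (a 0 i + b 0 i) / 2)) => ?; lra.
Qed.

(** Volume is additive under bisection, so a density bound [kappa] passes from the two halves to the
    whole box. *)
Lemma box_covered_bisect A (kappa : R) a b (i : 'I_d) (m := (a 0 i + b 0 i) / 2) :
  box_covered (A `&` box a (upd b i m)) (kappa * box_vol a (upd b i m)) ->
  box_covered (A `&` box (upd a i m) b) (kappa * box_vol (upd a i m) b) ->
  box_covered (A `&` box a b) (kappa * box_vol a b).
Proof.
move=> H1 H2; apply: sub_box_covered (box_coveredU H1 H2).
  by move=> x [Ax /(@box_split _ _ i m)[?|?]]; [left|right].
by rewrite -mulrDr box_vol_bisect.
Qed.

(** Induction on the total number of bisections. The number of halvings may depend on the
    coordinate, which yields thin columns as well as cubes. *)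
Lemma dyadic_subdivision (P : 'rV[R]_d -> 'rV[R]_d -> Prop) :
  (forall a b (i : 'I_d) (m := (a 0 i + b 0 i) / 2),
     P a (upd b i m) -> P (upd a i m) b -> P a b) ->
  forall (k : 'I_d -> nat) a b, (forall j, a 0 j <= b 0 j) ->
  (forall a' b', (forall j, a 0 j <= a' 0 j /\ b' 0 j <= b 0 j) ->
     (forall j, b' 0 j - a' 0 j = (b 0 j - a 0 j) / 2 ^+ k j) -> P a' b') ->
  P a b.
Proof.
move=> Psplit k a b; have [N] := ubnP (\sum_j k j).
elim: N k a b => // N IHN k a b kN ab H.
have [/forallP k0|] := boolP [forall j, k j == 0].
  by apply: H => // j; rewrite (eqP (k0 j)) expr0 divr1.
rewrite negb_forall => /existsP[i]; rewrite -lt0n => ki.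
pose k' j := if j == i then (k i).-1 else k j.
have k'N : (\sum_j k' j < N)%N.
  move: kN; rewrite (bigD1 i) //= (bigD1 i (F := k')) //= {1}/k' eqxx.
  rewrite (eq_bigr k (F1 := k')) => [|j /negbTE ji]; last by rewrite /k' ji.
  by rewrite -(ltn_predK ki) addSn ltnS.
have k'E j : 2 ^+ k j = (if j == i then 2 else 1) * 2 ^+ k' j :> R.
  by rewrite /k'; case: eqP => [->|_]; rewrite ?mul1r // -exprS prednK.
have abi := ab i.
apply: (Psplit a b i); apply: (IHN k') => //.
- by move=> j; rewrite updE; case: eqP => [->|_]; [lra|].
- move=> a' b' H1 H2; apply: H => j; have := H1 j; have := H2 j; rewrite updE.
    by case: eqP => [->|_] _ []; [lra|].
  rewrite k'E; case: eqP => [->|_] -> _; last by rewrite mul1r.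
  by rewrite invfM mulrA; congr (_ / _); lra.
- by move=> j; rewrite updE; case: eqP => [->|_]; [lra|].
- move=> a' b' H1 H2; apply: H => j; have := H1 j; have := H2 j; rewrite updE.
    by case: eqP => [->|_] _ []; [lra|].
  rewrite k'E; case: eqP => [->|_] -> _; last by rewrite mul1r.
  by rewrite invfM mulrA; congr (_ / _); lra.
Qed.

End BoxCovered.

(** The list is padded to a sequence by boxes [(0, 0)]. Their volume is 0 in positive dimension, but
    1 in dimension 0, where the product is empty; hence [d.+1]. *)
Lemma lebesgue_outer_box_covered (R : realType) (d : nat) (A : set 'rV[R]_d.+1) (v : R) :
  box_covered A v -> (lebesgue_outer A <= v%:E)%E.
Proof.
move=> [s Hs sv].
have vol00 : box_vol (0 : 'rV[R]_d.+1) 0 = 0.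
  by rewrite /box_vol big_ord_recl subrr maxxx mul0r.
apply: ge_ereal_inf; exists (\sum_(ab <- s) box_vol ab.1 ab.2)%:E; last by rewrite lee_fin.
exists (nth (0, 0) s).
  move=> x /Hs[ab abs abx]; exists (index ab s) => //=.
  by rewrite nth_index.
rewrite (@nneseries_split _ _ 0 (size s)) ?add0n; last first.
  by move=> k _; rewrite lee_fin box_vol_ge0.
rewrite eseries0 ?adde0; last by move=> k sk _; rewrite nth_default // vol00.
by rewrite (big_nth (0, 0)) sumEFin.
Qed.

(** * Sets where a bi-Lipschitz function is close to an integer *)

Lemma int_shift_bound (e : int) (k : nat) :
  - k%:Z <= e <= k%:Z -> 0 <= e + k%:Z /\ (absz (e + k%:Z)%R < (2 * k).+1)%N.
Proof. lia. Qed.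

Lemma dist_int_lt (R : realType) (t delta : R) :
  dist_int t < delta -> exists z : int, `|t - z%:~R| < delta.
Proof.
move=> /inf_lt[|_ [z _ <-] tz]; last by exists z.
by exists `|t - 0%:~R|, 0.
Qed.

Lemma box_vol_upd (R : realType) (d : nat) (a b : 'rV[R]_d) (i : 'I_d) (s t : R) :
  a 0 i <= b 0 i -> s <= t ->
  box_vol (upd a i s) (upd b i t) * (b 0 i - a 0 i) = (t - s) * box_vol a b.
Proof.
move=> ab st; rewrite /box_vol (bigD1 i) //= [X in _ = _ * X](bigD1 i) //=.
rewrite !updE eqxx !max_r ?subr_ge0 //.
under eq_bigr => j /negbTE ji do rewrite !updE ji.
by ring.
Qed.

(* 520 = 40 * 13: S meets at most 40 G s integers, each in a slab of width 13 delta / G. *)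
Lemma box_covered_near_integers (R : realType) (d : nat) (g : 'rV[R]_d -> R)
    (S : set 'rV[R]_d) (a b : 'rV[R]_d) (j : 'I_d) (G delta : R) :
  0 < G -> 0 < delta -> delta <= 1 -> 1 / 4 <= G * (b 0 j - a 0 j) ->
  S `<=` box a b -> (forall x, S x -> dist_int (g x) < delta) ->
  (forall x y, S x -> S y ->
     G / 2 * `|x 0 j - y 0 j| - delta <= `|g x - g y| <=
     2 * G * `|x 0 j - y 0 j| + delta) ->
  box_covered S (520 * delta * box_vol a b).
Proof.
move=> G0 d0 d1 Gs Sab Sd HS.
set s := b 0 j - a 0 j in Gs *.
have s0 : 0 < s by rewrite -(pmulr_rgt0 _ G0); lra.
have V0 := box_vol_ge0 a b.
have [[x0 Sx0]|nS] := pselect (exists x, S x); last first.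
  apply: box_covered0; last by move=> x Sx; apply: nS; exists x.
  by apply: mulr_ge0 V0; lra.
have [z0 Hz0] := dist_int_lt (Sd _ Sx0).
(* [X] bounds the distance from [z0] to any integer near a value of [g] on [S]: [g] varies by at
   most [2 * G * s + delta], and each of the two roundings costs [delta]. *)
pose X := 3 * delta + 2 * (G * s).
have X0 : 0 <= X by rewrite /X; lra.
have /andP[K1 K2] := truncn_itv X0.
set K := (Num.truncn X).+1 in K2; have K3 : K%:R <= X + 1 by rewrite -natr1 lerD2r.
(* The integers within [K] of [z0] are enumerated upwards from [z0 - K], so [2 * K + 1] indices
   suffice. *)
pose F k : set 'rV[R]_d :=
  [set x | S x /\ `|g x - (z0%:~R - K%:R + k%:R)| < delta].
pose v := 13 * delta / (G * s) * box_vol a b.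
have HF k : (k < (2 * K).+1)%N -> box_covered (F k) v.
  move=> _; have [[x1 [Sx1 Fx1]]|nF] := pselect (exists x, F k x); last first.
    apply: box_covered0; last by move=> x Fx; apply: nF; exists x.
    by rewrite !mulr_ge0 ?invr_ge0 ?mulr_ge0 // ltW.
  have dG : 0 < delta / G by rewrite divr_gt0.
  (* Values on [F k] differ by less than [2 * delta], so the lower Lipschitz bound keeps the [j]-th
     coordinates within [6 * (delta / G)]. The 7 on the right makes room for the half-open side. *)
  pose s1 := x1 0 j - 6 * (delta / G); pose t1 := x1 0 j + 7 * (delta / G).
  apply: sub_box_covered (box_covered_box (upd a j s1) (upd b j t1)).
    move=> x [Sx Fx] i; rewrite !updE; case: eqP => [->|_]; last exact: Sab.
    have /andP[H1 _] := HS _ _ Sx Sx1.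
    have H2 : `|g x - g x1| < 2 * delta.
      move: Fx Fx1; rewrite !ltr_norml; lra.
    have : `|x 0 j - x1 0 j| <= 6 * (delta / G).
      rewrite mulrA ler_pdivlMr //; lra.
    by rewrite ler_norml /s1 /t1; lra.
  have := @box_vol_upd _ _ a b j s1 t1; rewrite -/s.
  have -> : t1 - s1 = 13 * (delta / G) by rewrite /t1 /s1; ring.
  move=> H; rewrite -(ler_pM2r s0) H; last 2 first.
  - by rewrite -subr_ge0 ltW.
  - by rewrite /s1 /t1; lra.
  rewrite le_eqVlt; apply/orP; left; apply/eqP; rewrite /v; field.
  by rewrite !gt_eqF.
apply: sub_box_covered (box_covered_bigcup HF).
  move=> x Sx; have [z Hz] := dist_int_lt (Sd _ Sx).
  have /andP[_ H] := HS _ _ Sx Sx0.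
  have Hs : `|x 0 j - x0 0 j| <= s.
    have := Sab _ Sx j; have := Sab _ Sx0 j; rewrite ler_norml /s; lra.
  have H2 : 2 * G * `|x 0 j - x0 0 j| <= 2 * G * s by rewrite ler_wpM2l // mulr_ge0 // ltW.
  have HK : `|(z - z0)%:~R : R| <= K%:R.
    rewrite intrB; apply: le_trans (ltW K2); rewrite /X.
    have : `|g x - g x0| <= 2 * G * s + delta by lra.
    move: Hz Hz0; rewrite !ltr_norml !ler_norml; lra.
  move: HK; rewrite ler_norml [K%:R]pmulrn -mulrNz !ler_int => HK.
  have [e0 eK] : 0 <= z - z0 + K%:Z /\ ((absz (z - z0 + K%:Z)%R) < (2 * K).+1)%N.
    exact: int_shift_bound.
  exists (absz (z - z0 + K%:Z)%R) => //.
  split=> //; rewrite !pmulrn gez0_abs // intrD intrB.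
  by rewrite (_ : _ + (_ + _) = z%:~R) //; ring.
rewrite /v mulrA ler_wpM2r // mulrA [520 * delta]mulrC.
rewrite ler_pdivrMr ?mulr_gt0 //.
(* Here [2 * K + 1 <= 6 * delta + 4 * (G * s) + 3 <= 9 + 4 * (G * s)], and [9 <= 36 * (G * s)]
   because [G * s >= 1 / 4]. *)
have -> : (2 * K).+1%:R = 2 * K%:R + 1 :> R by rewrite -natr1 natrM.
rewrite (_ : delta * 520 * (G * s) = 40 * (G * s) * (13 * delta)); last by ring.
by rewrite ler_pM2r ?mulr_gt0 //; rewrite /X in K3; lra.
Qed.

(** * Partial derivatives and mean values along coordinate axes *)

Lemma upd_shift (R : realType) (d : nat) (z : 'rV[R]_d) (i : 'I_d) (t h : R) :
  upd z i (h + t) = h *: evec R i + upd z i t.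
Proof.
apply/rowP => j; rewrite !mxE !eqxx /=.
by case: eqP => _; rewrite ?mulr1 // mulr0 add0r.
Qed.

Lemma is_derive_upd (R : realType) (d : nat) (g : 'rV[R]_d -> R) (z : 'rV[R]_d)
    (i : 'I_d) (t : R) :
  derivable g (upd z i t) (evec R i) ->
  is_derive t 1 (fun s => g (upd z i s)) (pderiv g i (upd z i t)).
Proof.
move=> dg.
have E : (fun h => h^-1 *: (((fun s => g (upd z i s)) \o shift t) (h *: 1) - g (upd z i t)))
   = (fun h => h^-1 *: ((g \o shift (upd z i t)) (h *: evec R i) - g (upd z i t))).
  by apply/funext => h /=; rewrite -upd_shift /= [_ *: 1]mulr1.
by split; [rewrite /derivable E|rewrite /pderiv /derive E].
Qed.

(** A box is convex, so it contains the segment between the two points, and the one-variable mean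
    value theorem applies along it. *)
Lemma mvt_upd (R : realType) (d : nat) (g : 'rV[R]_d -> R) (a b z : 'rV[R]_d)
    (i : 'I_d) (s t : R) :
  (forall x, box a b x -> derivable g x (evec R i)) ->
  box a b (upd z i s) -> box a b (upd z i t) ->
  exists2 xi, box a b xi &
    g (upd z i t) - g (upd z i s) = pderiv g i xi * (t - s).
Proof.
move=> dg; wlog st : s t / s < t.
  move=> H bs bt; have [/H|/H|->] := ltgtP s t; first exact.
  - move=> /(_ bt bs)[xi bxi E]; exists xi => //.
    by rewrite -opprB E -mulrN opprB.
  - by exists (upd z i t) => //; rewrite !subrr mulr0.
move=> bs bt.
have Hbox u : s <= u <= t -> box a b (upd z i u).
  move=> sut j; have := bs j; have := bt j; rewrite !updE.
  by case: eqP => [_|//]; lra.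
have [||xi xist ->] := @MVT _ (fun u => g (upd z i u))
    (fun u => pderiv g i (upd z i u)) s t st.
- move=> u; rewrite in_itv /= => ust; apply/is_derive_upd/dg/Hbox; lra.
- apply: derivable_within_continuous => u; rewrite in_itv /= => ust.
  by have [] := is_derive_upd (dg _ (Hbox _ ust)).
exists (upd z i xi) => //; apply: Hbox; move: xist; rewrite in_itv /=; lra.
Qed.

(* Moving one coordinate at a time only uses the existence of the partial derivatives,
   not the differentiability of g. *)
Lemma mvt_box (R : realType) (d : nat) (g : 'rV[R]_d -> R) (a b x y : 'rV[R]_d) :
  (forall i z, box a b z -> derivable g z (evec R i)) ->
  box a b x -> box a b y ->
  exists2 xi : 'I_d -> 'rV[R]_d, (forall i, box a b (xi i)) &
    g x - g y = \sum_i pderiv g i (xi i) * (x 0 i - y 0 i).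
Proof.
move=> dg bx by_.
(* The points [hyb m] lead from [y] to [x] changing one coordinate at a time; the increments of [g]
   telescope. *)
pose hyb (m : nat) : 'rV[R]_d := \row_j if (j < m)%N then x 0 j else y 0 j.
have bhyb m : box a b (hyb m).
  by move=> j; rewrite mxE; case: ifP.
have hybS (i : 'I_d) : hyb i.+1 = upd (hyb i) i (x 0 i).
  apply/rowP => j; rewrite !mxE ltnS leq_eqVlt (inj_eq val_inj).
  by case: eqP => [->|].
have hyb_id (i : 'I_d) : hyb i = upd (hyb i) i (y 0 i).
  by apply/rowP => j; rewrite !mxE; case: eqP => // ->; rewrite ltnn.
have step (i : 'I_d) : exists xi, box a b xi /\
    g (hyb i.+1) - g (hyb i) = pderiv g i xi * (x 0 i - y 0 i).
  have [||xi bxi E] := @mvt_upd _ _ g a b (hyb i) i (y 0 i) (x 0 i) (dg i).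
  - by rewrite -hyb_id.
  - by rewrite -hybS.
  by exists xi; split=> //; rewrite hybS {2}hyb_id.
have [xi Hxi] := choice step.
exists xi => [i|]; first by have [] := Hxi i.
rewrite -(eq_bigr _ (fun i _ => (Hxi i).2)).
rewrite -(big_mkord xpredT (fun i => g (hyb i.+1) - g (hyb i))) telescope_sumr //.
congr (g _ - g _); apply/rowP => j; rewrite mxE ?ltn_ord //.
Qed.

Lemma is_derive_mulmx (R : realType) (V : normedModType R) (n : nat) (f : V -> 'rV[R]_n)
    (Q : 'cV[R]_n) (x v : V) :
  derivable f x v ->
  is_derive x v (fun y => (f y *m Q) 0 0) (('D_v f x *m Q) 0 0).
Proof.
move=> df; have /derivable_mxP dfij := df.
have -> : (fun y => (f y *m Q) 0 0) = \sum_j (Q j 0 *: (fun y => f y 0 j)).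
  apply/funext => y; rewrite mxE fct_sumE; apply: eq_bigr => j _.
  by rewrite mulrC.
apply: is_derive_eq (is_derive_sum _) _.
  by move=> j; apply: is_deriveZ; apply: derivableP; apply: dfij.
rewrite mxE; apply: eq_bigr => j _.
by rewrite derive_mx // mxE mulrC.
Qed.

(** * Covering estimates on cubes *)

Lemma dyadic_scale (R : realType) (x : R) :
  1 / 4 <= x -> exists k : nat, 1 / 4 <= x / 2 ^+ k <= 1 / 2.
Proof.
have [N] : exists N : nat, x <= 2 ^+ N / 2.
  (* One unit of the exponent pays for the division by 2; the rest uses [m < 2 ^ m]. *)
  exists (Num.truncn (`|x|)).+2.
  have /andP[_ H] := truncn_itv (normr_ge0 x).
  apply: le_trans (ler_norm x) _; apply: le_trans (ltW H) _.
  rewrite exprSr mulfK ?pnatr_eq0 // -natrX ler_nat.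
  exact/ltnW/ltn_expl.
elim: N x => [|N IHN] x xN x4.
  by exists 0%N; rewrite expr0 divr1 x4; move: xN; rewrite expr0.
have [x2|x2] := leP x (1 / 2); first by exists 0%N; rewrite expr0 divr1 x4.
(* As [x] exceeds 1/2, its half is still at least 1/4. *)
have [||k Hk] := IHN (x / 2); try lra.
  by rewrite ler_pM2r ?invr_gt0 ?ltr0n //; move: xN; rewrite exprSr mulfK ?pnatr_eq0.
by exists k.+1; rewrite exprS invfM mulrA.
Qed.

Lemma ler_norm_sum_bound (R : realType) (d : nat) (P : pred 'I_d) (u v : 'I_d -> R) (p q : R) :
  0 <= p -> 0 <= q ->
  (forall i, P i -> `|u i| <= p) -> (forall i, P i -> `|v i| <= q) ->
  `|\sum_(i | P i) u i * v i| <= d%:R * (p * q).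
Proof.
move=> p0 q0 up vq; apply: le_trans (ler_norm_sum _ _ _) _.
apply: (@le_trans _ _ (\sum_(i | P i) p * q)).
  by apply: ler_sum => i Pi; rewrite normrM ler_pM // ?up ?vq.
rewrite sumr_const -[leLHS]mulr_natl ler_wpM2r ?mulr_ge0 // ler_nat.
by rewrite -[X in (_ <= X)%N]card_ord max_card.
Qed.

Lemma box_dist (R : realType) (d : nat) (a b x y : 'rV[R]_d) (i : 'I_d) :
  box a b x -> box a b y -> `|x 0 i - y 0 i| <= b 0 i - a 0 i.
Proof. by move=> /(_ i) hx /(_ i) hy; rewrite ler_norml; lra. Qed.

Section Cube.
Variables (R : realType) (d : nat) (g : 'rV[R]_d -> R) (h : 'I_d -> 'rV[R]_d -> R).
Variables (M D delta : R) (S : set 'rV[R]_d).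
Hypotheses (M0 : 0 <= M) (D0 : 0 < D) (dMD : d%:R * M = D ^+ 2).
Hypotheses (delta0 : 0 < delta) (delta1 : delta <= 1).
Hypothesis Sdist : forall x, S x -> dist_int (g x) < delta.
Hypothesis Sgrad : forall x, S x -> exists i, D <= `|h i x|.

(** The functions [h i] agree with the partial derivatives of [g] on the box. Being given
    separately, they can be differentiated again without knowing that this agreement holds on a
    neighbourhood. *)
Definition C2_bounded_on_box (a b : 'rV[R]_d) : Prop :=
  forall i x, box a b x ->
    [/\ derivable g x (evec R i), pderiv g i x = h i x,
        (forall j, derivable (h j) x (evec R i)) &
        (forall j, `|pderiv (h j) i x| <= M)].

(** The upper bound on [D * s] keeps each partial derivative within half of the largest one from its
    value at [x0]; the lower bound makes the number of integers met at most a multiple of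
    [G * s]. *)
Lemma box_covered_cube (a b : 'rV[R]_d) (s : R) :
  C2_bounded_on_box a b -> (forall j, b 0 j - a 0 j = s) ->
  1 / 4 <= D * s <= 1 / 2 ->
  box_covered (S `&` box a b) (520 * delta * box_vol a b).
Proof.
move=> gh abs /andP[Ds4 Ds2].
have s0 : 0 < s by rewrite -(pmulr_rgt0 _ D0); lra.
have [[x0 [Sx0 bx0]]|nS] := pselect (exists x, (S `&` box a b) x); last first.
  apply: box_covered0; last by move=> x Sx; apply: nS; exists x.
  by apply: mulr_ge0 (box_vol_ge0 a b); have := delta0; lra.
have [j Gmax GD] : exists2 j, forall i, `|h i x0| <= `|h j x0| & D <= `|h j x0|.
  have [i0 Di0] := Sgrad Sx0.
  case: (@Order.TotalTheory.arg_maxP _ _ _ i0 xpredT (fun i => `|h i x0|)) => // j _ H.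
  by exists j => [i|]; [exact: H|apply: le_trans Di0 _; exact: H].
set G := `|h j x0| in Gmax GD.
have G0 : 0 < G by apply: lt_le_trans GD.
(* By the mean value theorem the variation is at most [d * M * s = D ^ 2 * s <= D / 2 <= G / 2]. *)
have var i y : box a b y -> `|h i y - h i x0| <= G / 2.
  move=> by_; have [k z bz|xi bxi ->] := @mvt_box _ _ (h i) a b y x0 _ by_ bx0.
    by have [_ _ /(_ i)] := gh k z bz.
  apply: (@le_trans _ _ (d%:R * (M * s))).
    apply: ler_norm_sum_bound => // [|k _|k _]; first exact: ltW.
      by have [_ _ _ /(_ i)] := gh k _ (bxi k).
    by rewrite -(abs k) box_dist.
  rewrite mulrA dMD expr2 -mulrA; apply: (@le_trans _ _ (D / 2)); last by lra.
  by rewrite ler_pM2l //; lra.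
(* On the cube all partial derivatives are at most [3 / 2 * G], so [K] halvings in the directions
   other than [j] leave a variation of at most [delta] from those directions. *)
have [K HK] : exists K : nat, d%:R * (3 / 2 * G * (s / 2 ^+ K)) <= delta.
  pose X := d%:R * (3 / 2 * G * s) / delta.
  have Gs0 : 0 <= 3 / 2 * G * s by rewrite !mulr_ge0 // ltW.
  have X0 : 0 <= X by rewrite divr_ge0 ?mulr_ge0 // ltW.
  exists (Num.truncn X).+1; have /andP[_ H] := truncn_itv X0.
  set K := (Num.truncn X).+1 in H *.
  have delta_neq0 : delta != 0 by rewrite gt_eqF.
  have K_neq0 : 2 ^+ K != 0 :> R by rewrite expf_neq0 // pnatr_eq0.
  rewrite [leLHS](_ : _ = delta * (X / 2 ^+ K)); last by rewrite /X; field; apply/andP.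
  rewrite ger_pMr // ler_pdivrMr ?exprn_gt0 // mul1r.
  apply: le_trans (ltW H) _; rewrite -natrX ler_nat.
  exact/ltnW/ltn_expl.
have ab i : a 0 i <= b 0 i by rewrite -subr_ge0 abs ltW.
apply: (@dyadic_subdivision _ _
    (fun a b => box_covered (S `&` box a b) (520 * delta * box_vol a b))
    _ (fun i => if i == j then 0%N else K) a b ab).
  by move=> a' b' i m; exact: box_covered_bisect.
move=> a' b' sub sides.
have sub' x : box a' b' x -> box a b x.
  by move=> bx i; have := bx i; have := sub i; lra.
have sj : b' 0 j - a' 0 j = s by rewrite sides eqxx expr0 divr1 abs.
apply: (@box_covered_near_integers _ _ g _ a' b' j G delta) => //.
- by rewrite sj; apply: le_trans Ds4 _; rewrite ler_wpM2r // ltW.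
- by move=> x [/Sdist].
move=> x y [_ bx] [_ by_].
have [i z bz|xi bxi ->] := @mvt_box _ _ g a b x y _ (sub' _ bx) (sub' _ by_).
  by have [] := gh i z bz.
rewrite (bigD1 j) //=; set E := \sum_(_ | _) _.
have HE : `|E| <= delta.
  apply: le_trans HK; apply: ler_norm_sum_bound => [||i ij|i /negbTE ij].
  - by rewrite mulr_ge0 // ltW.
  - by rewrite divr_ge0 ?exprn_ge0 // ltW.
  - have [_ -> _ _] := gh i _ (bxi i); have := var i _ (bxi i); have := Gmax i.
    by rewrite !ler_norml; lra.
  - by apply: le_trans (box_dist i bx by_) _; rewrite sides ij abs.
have [_ -> _ _] := gh j _ (bxi j).
(* The slope in direction [j] stays within [G / 2] of [G]; the error [E] accounts for the terms
   [delta] in the bi-Lipschitz bounds. *)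
have H1 : G / 2 <= `|h j (xi j)| <= 3 / 2 * G.
  have := var j _ (bxi j); rewrite /G.
  have := ler_normD (h j (xi j) - h j x0) (h j x0); rewrite subrK.
  have := ler_normD (h j x0 - h j (xi j)) (h j (xi j)); rewrite subrK distrC; lra.
set t := x 0 j - y 0 j; set e := h j (xi j) * t.
have He : G / 2 * `|t| <= `|e| <= 2 * G * `|t|.
  rewrite normrM !ler_wpM2r ?normr_ge0 //; lra.
have := ler_normD e E; have := ler_normB (e + E) E; rewrite addrK; lra.
Qed.

(** Halving all sides equally often brings [D * s] into the range required of a small cube, and the
    density bound passes back up. *)
Lemma box_covered_large_cube (a b : 'rV[R]_d) (s : R) :
  C2_bounded_on_box a b -> (forall j, b 0 j - a 0 j = s) -> 1 / 4 <= D * s ->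
  box_covered (S `&` box a b) (520 * delta * box_vol a b).
Proof.
move=> gh abs Ds; have [k] := dyadic_scale Ds; rewrite -mulrA => Hk.
have ab i : a 0 i <= b 0 i.
  by rewrite -subr_ge0 abs ltW // -(pmulr_rgt0 _ D0); lra.
apply: (@dyadic_subdivision _ _
    (fun a b => box_covered (S `&` box a b) (520 * delta * box_vol a b))
    _ (fun=> k) a b ab).
  by move=> a' b' i m; exact: box_covered_bisect.
move=> a' b' sub sides; apply: box_covered_cube Hk.
  move=> i x bx; apply: gh => l; have := bx l; have := sub l; lra.
by move=> j; rewrite sides abs.
Qed.

End Cube.

(** * Bounds for products with an integer vector, and assembly *)

Lemma le_entry_mx_norm (R : realType) (m n : nat) (N : 'M[R]_(m, n)) i j : `|N i j| <= `|N|.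
Proof. by rewrite [leRHS]/Num.Def.normr /= mx_normrE (le_bigmax _ _ (i, j)). Qed.

Lemma norm_mulmx_le (R : realType) (n : nat) (N : 'rV[R]_n) (Q : 'cV[R]_n) :
  `|(N *m Q) 0 0| <= n%:R * (`|N| * `|Q|).
Proof.
by rewrite mxE; apply: ler_norm_sum_bound => // i _; exact: le_entry_mx_norm.
Qed.

Unset Implicit Arguments.
Set Strict Implicit.

Theorem theorem1p3 (R : realType) (d : nat) :
  exists C : R,
  forall (n : nat) (c : 'rV[R]_d) (r : R) (f : 'rV[R]_d -> 'rV[R]_n)
         (delta L : R) (q : 'cV[int]_n),
    0 < r ->
    C2_on (ball c (2 * r)) f ->
    0 < delta ->
    L%:E = ereal_sup [set (`|pderiv (pderiv f p.1.2) p.1.1 p.2|)%:E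
                     | p in [set p : 'I_d * 'I_d * 'rV[R]_d | ball c (2 * r) p.2]] ->
    0 < L ->
    1 / (4 * n%:R * L * r ^+ 2) <= `|map_mx intr q : 'cV[R]_n| ->
    (lebesgue_outer
       [set x | ball c r x /\
                (dist_int ((f x *m map_mx intr q) 0 0) < delta)%R /\
                (Num.sqrt (n%:R * d%:R * L * `|map_mx intr q : 'cV[R]_n|)
                  <= `|\row_(i < d) ((pderiv f i x *m map_mx intr q) 0 0)|)%R]
     <= (C * delta)%:E * lebesgue_outer (ball c r))%E.
Proof.
exists 520; case: d => [|d] n c r f delta L q r0 [_ [df [_ [ddf _]]]] delta0 HL L0 Hq.
  (* In dimension 0 the supremum runs over the empty set and is [-oo], which no real [L] equals. *)
  have : (L%:E <= -oo)%E.
    by rewrite HL; apply: ge_ereal_sup => y [[[[]]]].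
  by rewrite leNgt ltNyr.
set Q := map_mx intr q in Hq *.
have ball0 := lebesgue_outer_ball_ge c r0.
have vol0 : 0 <= (2 * r) ^+ d.+1 by rewrite exprn_ge0 // mulr_ge0 // ltW.
have Lub i j x : ball c (2 * r) x -> `|pderiv (pderiv f j) i x| <= L.
  by move=> bx; rewrite -lee_fin HL; apply: ereal_sup_ubound; exists (i, j, x).
(* For [n = 0] the quotient in [Hq] would be 0 by convention and say nothing; this case contradicts
   [0 < L], as all second derivatives vanish. *)
have n0 : (0 < n)%N.
  rewrite lt0n; apply/eqP => n0; move: L0; rewrite ltNge => /negP; apply.
  rewrite -lee_fin HL; apply: ge_ereal_sup => _ [p _ <-]; rewrite lee_fin.
  rewrite (_ : pderiv _ _ _ = 0) ?normr0 //.
  by apply/rowP => j; have := ltn_ord j; rewrite {2}n0.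
pose M := n%:R * (L * `|Q|).
have M1 : 1 <= 4 * M * r ^+ 2.
  move: Hq; rewrite ler_pdivrMr; last by rewrite !mulr_gt0 ?ltr0n ?exprn_gt0.
  by rewrite (_ : `|Q| * _ = 4 * M * r ^+ 2) // /M; ring.
have M0 : 0 <= M by rewrite !mulr_ge0 // ltW.
set D := Num.sqrt (n%:R * d.+1%:R * L * `|Q|).
have D2 : d.+1%:R * M = D ^+ 2.
  rewrite sqr_sqrtr; first by rewrite /M; ring.
  by rewrite !mulr_ge0 // ltW.
(* Squared, this reads [1 <= d.+1 * (4 * M * r ^ 2)], a consequence of the lower bound on [q]. *)
have Dr : 1 <= D * (2 * r).
  rewrite -(@ler_pXn2r _ 2) ?nnegrE ?mulr_ge0 ?sqrtr_ge0 ?ler01 ?(ltW r0) //.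
  rewrite expr1n exprMn -D2 exprMn; apply: le_trans M1 _.
  rewrite (_ : _ * (2 ^+ 2 * _) = d.+1%:R * (4 * M * r ^+ 2)); last by ring.
  by rewrite ler_peMl ?mulr_ge0 ?exprn_ge0 ?ler1n // ltW.
have D0 : 0 < D.
  have r2 : 0 < 2 * r by rewrite mulr_gt0.
  by rewrite -(pmulr_lgt0 _ r2); apply: lt_le_trans Dr.
set S := [set x | _].
(* This half-open cube contains the ball, lies in the doubled ball, and has side [2 * r]. *)
pose a : 'rV[R]_d.+1 := \row_j (c 0 j - r); pose b : 'rV[R]_d.+1 := \row_j (c 0 j + r).
have ab j : b 0 j - a 0 j = 2 * r by rewrite !mxE; ring.
have volab : box_vol a b = (2 * r) ^+ d.+1.
  rewrite /box_vol (eq_bigr (fun=> 2 * r)) ?prodr_const ?card_ord // => j _.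
  by rewrite ab max_r // mulr_ge0 // ltW.
have Sab : S `<=` box a b.
  move=> x [[_ cx] _] j; have := cx 0 j; rewrite /ball /= !mxE ltr_distlC; lra.
have boxball x : box a b x -> ball c (2 * r) x.
  move=> bx; split=> [|i j]; first by rewrite mulr_gt0.
  have := bx j; rewrite (ord1 i) !mxE /ball /= ltr_distlC; lra.
suff HS : box_covered S (520 * delta * (2 * r) ^+ d.+1).
  apply: le_trans (lebesgue_outer_box_covered HS) _.
  have C0 : 0 <= 520 * delta by lra.
  by rewrite EFinM lee_wpmul2l // lee_fin.
(* For [delta > 1] the whole cube is an admissible cover. *)
have [delta1|delta1] := leP delta 1; last first.
  apply: sub_box_covered Sab _ (box_covered_box a b).
  by rewrite volab ler_peMl //; lra.
pose g x := (f x *m Q) 0 0; pose h i x := (pderiv f i x *m Q) 0 0.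
rewrite -volab; apply: (@sub_box_covered _ _ _ (S `&` box a b)) (le_refl _) _.
  by move=> x Sx; split=> //; exact: Sab.
apply: (@box_covered_large_cube _ _ g h M D) ab _ => //.
- by move=> x [_ []].
- move=> x [_ [_ Hx]]; set v := \row_i _ in Hx.
  (* The norm is positive, since it is at least [D], so it is attained at an entry. *)
  have /mx_norm_neq0[[i j] /= E] : mx_norm v != 0.
    by rewrite gt_eqF //; apply: lt_le_trans Hx.
  by exists j; move: Hx; rewrite [X in _ <= X]E (ord1 i) mxE.
- move=> i x /boxball bx; have xU := mem_set bx.
  have Hf := is_derive_mulmx Q (df i x xU).
  have Hh j := is_derive_mulmx Q (ddf i j x xU).
  split=> [||j|j].
  + by have [] := Hf.
  + by have [] := Hf.
  + by have [] := Hh j.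
  + have [_ E] := Hh j; rewrite /pderiv [X in `|X|]E.
    apply: le_trans (norm_mulmx_le _ _) _.
    by rewrite ler_wpM2l // ler_wpM2r //; exact: Lub.
- by lra.
Qed.
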